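(* The principal AD-rigid graphs form a proper subclass of the amenable graphs: every principal AD-rigid graph is amenable to color refinement, and there exists a graph that is amenable to color refinement but not principal AD-rigid.
   Context: All graphs are finite and simple. For a graph $G$, $A_G$ is the adjacency matrix, $D_G$ the diagonal degree matrix, $\mathbf 1$ the all-ones vector. Two graphs $G,H$ are principal equivalent if $\mathbf 1^Tw(A_G,D_G)\mathbf 1=\mathbf 1^Tw(A_H,D_H)\mathbf 1$ for every noncommutative polynomial $w\in\mathbb R\langle x,y\rangle$. A graph is principal AD-rigid if every graph principal equivalent to it is isomorphic to it. Color refinement: start with all vertices having the same color; in each round, the new color of a vertex is the pair consisting of its old color and the multiset of old colors of its neighbors; iterate until the partition into color classes is stable. Two graphs are color-refinement equivalent if, when color refinement is run on their disjoint union, each color class of the stable coloring contains equally many vertices of both graphs. A graph $G$ is amenable to color refinement if every graph that is color-refinement equivalent to $G$ is isomorphic to $G$. *)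

(* Defs.v *)
From HB Require Import structures.
From mathcomp Require Import all_boot all_order all_algebra.
From mathcomp Require Import finmap multiset.
From mathcomp Require Import monalg.
From mathcomp Require Import reals.

Set Implicit Arguments.
Unset Strict Implicit.
Unset Printing Implicit Defensive.

Import GRing.Theory.
Local Open Scope ring_scope.

Record sgraph := SGraph {
  vertex :> finType;
  adj : rel vertex;
  adj_sym : symmetric adj;
  adj_irr : irreflexive adj
}.

Definition neighbors (G : sgraph) (u : G) : {set G} := [set v | adj u v].

Definition isomorphic (G H : sgraph) : Prop :=
  exists2 f : G -> H, bijective f & {mono f : u v / adj u v}.

(* Matrices are indexed by 'I_#|G| through the library enumeration of the
   vertices. *)
Definition adj_mx (R : nzRingType) (G : sgraph) : 'M[R]_#|G| :=
  \matrix_(i, j) (adj (enum_val i) (enum_val j))%:R.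

Definition deg_mx (R : nzRingType) (G : sgraph) : 'M[R]_#|G| :=
  diag_mx (\row_i #|neighbors (enum_val i)|%:R).

(* R<x, y> is the algebra over R of the free monoid on two letters: the letter
   false stands for x, the letter true for y. *)
Definition ncpoly (R : nzRingType) := {malg R[{fmonom bool}]}.

(* w(A, D), with products in the matrix ring.  The library evaluation [mmap]
   needs a nontrivial target ring, which 'M_n is not when n = 0. *)
Definition nc_eval (R : nzRingType) (n : nat) (A D : 'M[R]_n) (w : ncpoly R) :
    'M[R]_n :=
  \sum_(m <- msupp w)
    mcoeff m w *: \prod_(b <- fmonom_val m) (if b then D else A).

Definition principal_value (R : nzRingType) (G : sgraph) (w : ncpoly R) : R :=
  let one : 'cV[R]_#|G| := const_mx 1 in
  (one^T *m nc_eval (adj_mx R G) (deg_mx R G) w *m one) 0 0.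

Definition principal_equivalent (R : realType) (G H : sgraph) : Prop :=
  forall w : ncpoly R, principal_value G w = principal_value H w.

Definition principal_AD_rigid (R : realType) (G : sgraph) : Prop :=
  forall H : sgraph, principal_equivalent R G H -> isomorphic G H.

Fixpoint color (k : nat) : choiceType :=
  if k is k'.+1 then (color k' * {mset (color k')}%mset)%type else unit.

Fixpoint refine (G : sgraph) (k : nat) : G -> color k :=
  if k is k'.+1 return G -> color k
  then fun u => (refine k' u,
                 seq_mset [seq refine k' v | v <- enum (neighbors u)])
  else fun=> tt.

Definition color_partition (G : sgraph) (k : nat) : {set {set G}} :=
  preim_partition (@refine G k) [set: G].

Definition stable (G : sgraph) (k : nat) : bool :=
  color_partition G k.+1 == color_partition G k.

Lemma stable_exists (G : sgraph) : exists k, stable G k.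
Proof.
pose E k := [set p : G * G | refine k p.1 == refine k p.2].
have subE k : E k.+1 \subset E k.
  by apply/subsetP => p; rewrite !inE /= -pair_eqE => /andP[].
have stE k : E k.+1 = E k -> stable G k.
  move=> eqE; apply/eqP; rewrite /color_partition /preim_partition.
  apply: eq_imset => u; apply/setP => v; rewrite !inE.
  by have /setP/(_ (u, v)) := eqE; rewrite !inE.
suff [k /eqP /stE ?] : exists k, E k.+1 == E k by exists k.
case: (boolP [exists k : 'I_#|E 0%N|.+1, E k.+1 == E k]).
  by case/existsP => k Hk; exists k.
rewrite negb_exists => /forallP neqE.
suff le k : (k <= #|E 0%N|.+1 -> #|E k| + k <= #|E 0%N|)%N.
  by have := leq_trans (leq_addl _ _) (le _ (leqnn _)); rewrite ltnn.
elim: k => [|k IH] lek; first by rewrite addn0.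
apply: leq_trans (IH (ltnW lek)); rewrite addnS -addSn leq_add2r.
by apply: proper_card; rewrite properEneq subE (neqE (Ordinal lek)).
Qed.

Definition stable_round (G : sgraph) : nat := ex_minn (stable_exists G).

Definition color_classes (G : sgraph) : {set {set G}} :=
  color_partition G (stable_round G).

Section DisjointUnion.
Variables G H : sgraph.

Definition dunion_adj : rel (G + H) := fun x y =>
  match x, y with
  | inl u, inl v => adj u v
  | inr u, inr v => adj u v
  | _, _ => false
  end.

Lemma dunion_sym : symmetric dunion_adj.
Proof. by case=> u [] v //=; rewrite adj_sym. Qed.

Lemma dunion_irr : irreflexive dunion_adj.
Proof. by case=> u /=; rewrite adj_irr. Qed.

Definition dunion : sgraph := SGraph dunion_sym dunion_irr.

End DisjointUnion.

Definition cr_equivalent (G H : sgraph) : Prop :=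
  forall C : {set dunion G H}, C \in color_classes (dunion G H) ->
    #|[set u : G | inl u \in C]| = #|[set v : H | inr v \in C]|.

Definition amenable (G : sgraph) : Prop :=
  forall H : sgraph, cr_equivalent G H -> isomorphic G H.

(* Main.v *)
Require Import Defs.
From mathcomp Require Import all_boot all_order all_algebra.
From mathcomp Require Import reals.
From mathcomp Require Import finmap multiset monalg.

Set Implicit Arguments.
Unset Strict Implicit.
Unset Printing Implicit Defensive.

Import GRing.Theory.

(** Write [walk s u] for the [u]-th entry of the word [s] in the adjacency and
    degree matrices applied to the all-ones vector.  Expanding a noncommutative
    polynomial into words shows that two graphs are principal equivalent as
    soon as the sums of [walk s] over their vertices agree for every word [s]
    ([principal_equivalent_walk]).

    Rigid graphs are amenable because color refinement equivalence is finer
    than principal equivalence.  On the disjoint union of two graphs, [walk s]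
    is constant on every stable color class ([walk_stable_color]), and color
    refinement equivalence is exactly what yields a bijection between the
    vertex sets that preserves stable colors ([cr_equivalent_bijection]); this
    bijection matches the two sums term by term.

    The inclusion is proper because color refinement sees individual entries of
    the vectors [walk s], while principal equivalence only sees their inner
    products.  So two graphs are principal equivalent whenever some matrix
    whose rows and columns all have the same nonzero sum, possibly with negative
    entries, intertwines their adjacency and degree matrices ([intertwiner_principal]).  Take four
    points and the six pairs of points as vertices, and join four of the pairs
    into a path.  Then join each pair to its two points for one graph, and to
    the two points outside it for the other.  This is a Godsil-McKay switching
    with respect to the four points: every pair sees exactly half of them, and
    the reflection [J/2 - I] on the points (the identity on the pairs) is such
    an intertwiner; it respects degrees, since all points keep degree three.
    In the first graph the numbers of walks of length three from the ten
    vertices are distinct, so each vertex is identified by its stable color,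
    and this makes a graph amenable ([walk_injective_amenable]).  The two
    graphs are not isomorphic: a point of the first starts a number of walks of
    length two that no vertex of the second does. *)

(** * Word vectors *)

(** The letter [true] stands for the degree matrix and [false] for the
    adjacency matrix, so that [nseq k false] counts the walks of length [k]. *)
Fixpoint walk (G : sgraph) (s : seq bool) (u : G) : nat :=
  if s is b :: s' then
    if b then #|neighbors u| * walk s' u else \sum_(v | adj u v) walk s' v
  else 1.

Lemma walk_cons (G : sgraph) b s (u : G) :
  walk (b :: s) u
  = if b then #|neighbors u| * walk s u else \sum_(v | adj u v) walk s v.
Proof. by []. Qed.

Lemma card_neighbors (G : sgraph) (u : G) :
  #|neighbors u| = \sum_(v | adj u v) 1.
Proof. by rewrite sum1dep_card. Qed.

Lemma walk_iso (G H : sgraph) (f : G -> H) (s : seq bool) (u : G) :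
  bijective f -> {mono f : u v / adj u v} -> walk s (f u) = walk s u.
Proof.
move=> bij_f adj_f.
have sum_f (F : H -> nat) x :
    \sum_(v | adj (f x) v) F v = \sum_(v | adj x v) F (f v).
  rewrite (reindex f); last exact: onW_bij.
  by apply: eq_bigl => v; rewrite adj_f.
elim: s u => //= -[] s IH u; first by rewrite IH !card_neighbors sum_f.
by rewrite sum_f; apply: eq_bigr => v _; rewrite IH.
Qed.

Lemma walk_inl (G H : sgraph) s (u : G) :
  walk s (inl u : dunion G H) = walk s u.
Proof.
have sum_inl (F : dunion G H -> nat) x :
    \sum_(y | adj (inl x : dunion G H) y) F y = \sum_(v | adj x v) F (inl v).
  by rewrite /= big_sumType /= [X in _ + X]big_pred0 ?addn0.
elim: s u => // -[] s IH u; rewrite !walk_cons.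
  by rewrite IH !card_neighbors sum_inl.
by rewrite sum_inl; apply: eq_bigr.
Qed.

Lemma walk_inr (G H : sgraph) s (u : H) :
  walk s (inr u : dunion G H) = walk s u.
Proof.
have sum_inr (F : dunion G H -> nat) x :
    \sum_(y | adj (inr x : dunion G H) y) F y = \sum_(v | adj x v) F (inr v).
  by rewrite /= big_sumType /= big_pred0 ?add0n.
elim: s u => // -[] s IH u; rewrite !walk_cons.
  by rewrite IH !card_neighbors sum_inr.
by rewrite sum_inr; apply: eq_bigr.
Qed.

(** * Principal values as sums of word vectors *)

Section PrincipalValue.
Local Open Scope ring_scope.

Lemma mulmx_word (R : nzRingType) (G : sgraph) (s : seq bool) :
  (\prod_(b <- s) (if b then deg_mx R G else adj_mx R G)) *m const_mx 1
  = \col_i (walk s (enum_val i))%:R :> 'cV[R]_#|G|.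
Proof.
elim: s => [|b s IH].
  by rewrite big_nil mul1mx; apply/matrixP => i j; rewrite !mxE.
rewrite big_cons -[LHS]mulmxA IH; apply/matrixP => i j; rewrite [RHS]mxE.
case: b => /=.
  by rewrite /deg_mx mul_diag_mx !mxE natrM.
rewrite !mxE natr_sum [RHS]big_mkcond [RHS]big_enum_val /=.
apply: eq_bigr => k _; rewrite !mxE.
by case: ifP => _; rewrite ?mul1r ?mul0r.
Qed.

Lemma principal_valueE (R : comNzRingType) (G : sgraph) (w : ncpoly R) :
  principal_value G w
  = \sum_(m <- msupp w) mcoeff m w * (\sum_u walk (fmonom_val m) (u : G))%:R.
Proof.
rewrite /principal_value /nc_eval -mulmxA mulmx_suml mulmx_sumr summxE.
apply: eq_bigr => m _; rewrite -scalemxAl mulmx_word -scalemxAr mxE; congr (_ * _).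
rewrite mxE natr_sum [RHS]big_enum_val /=.
by apply: eq_bigr => i _; rewrite !mxE mul1r.
Qed.

(** Both principal values are the same linear combination of the sums over the
    words in the support of the polynomial. *)
Lemma principal_equivalent_walk (R : realType) (G H : sgraph) :
  (forall s, \sum_u walk s (u : G) = \sum_v walk s (v : H))%N ->
  principal_equivalent R G H.
Proof. by move=> eqw w; rewrite !principal_valueE; under eq_bigr do rewrite eqw. Qed.

End PrincipalValue.

(** * Stable colorings *)

Section StableColoring.
Variable G : sgraph.

Definition stable_color (u : G) := refine (stable_round G) u.

Lemma stable_color_classP (x : G) :
  [set y | stable_color x == stable_color y] \in color_classes G.
Proof.
apply/imsetP; exists x => //; apply/setP => y; by rewrite !inE.
Qed.

Lemma color_partitionP (k : nat) (u v : G) :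
  (v \in pblock (color_partition G k) u) = (refine k u == refine k v).
Proof.
rewrite pblock_equivalence_partition ?inE //.
by move=> x y z _ _ _; split=> [|/eqP->].
Qed.

(** One more round of refinement would pair each color with the multiset of the
    colors of the neighbors, and stability says that this splits no class. *)
Lemma stable_color_nbrs (u v : G) : stable_color u = stable_color v ->
  perm_eq [seq stable_color w | w <- enum (neighbors u)]
          [seq stable_color w | w <- enum (neighbors v)].
Proof.
rewrite /stable_color /stable_round; case: ex_minnP => k /eqP stk _ eq_uv.
have : refine k.+1 u == refine k.+1 v.
  by rewrite -color_partitionP stk color_partitionP eq_uv.
by rewrite /= xpair_eqE => /andP[_ /eqP/eq_seq_msetP].
Qed.

Lemma stable_color_adj (u v u' : G) :
  stable_color u = stable_color v -> adj u u' ->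
  exists2 v', adj v v' & stable_color u' = stable_color v'.
Proof.
move=> /stable_color_nbrs/perm_mem eq_uv adj_uu'.
have := eq_uv (stable_color u'); rewrite map_f ?mem_enum ?inE // => /esym.
by case/mapP => v'; rewrite mem_enum inE => ? ->; exists v'.
Qed.

(** By induction on the word: [walk s] is a function of the stable color, and
    equally colored vertices see the same multiset of colors. *)
Lemma walk_stable_color s (u v : G) :
  stable_color u = stable_color v -> walk s u = walk s v.
Proof.
elim: s u v => //= b s IH u v eq_uv.
(* [walk s] as a function of colors; the value 0 is for unattained colors. *)
pose g c := if [pick w | stable_color w == c] is Some w then walk s w else 0.
have gE w : walk s w = g (stable_color w).
  rewrite /g; case: pickP => [w' /eqP/IH -> //|/(_ w)]; by rewrite eqxx.
have sumE w : \sum_(x | adj w x) walk s x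
    = \sum_(c <- [seq stable_color x | x <- enum (neighbors w)]) g c.
  rewrite big_map big_enum /=; apply: eq_big => [x|x _]; by rewrite ?inE ?gE.
have degE w : #|neighbors w|
    = size [seq stable_color x | x <- enum (neighbors w)].
  by rewrite size_map -cardE.
have perm_uv := stable_color_nbrs eq_uv.
case: b; last by rewrite !sumE; apply: perm_big.
by rewrite !degE (perm_size perm_uv) (IH u v).
Qed.

End StableColoring.

(** * Color refinement equivalence *)

(** Send the [i]-th element of each fiber of [a] to the [i]-th element of the
    fiber of [b] over the same value. *)
Lemma fiber_injection (T : eqType) (A B : finType) (a : A -> T) (b : B -> T) :
  (forall t, #|[set x | a x == t]| <= #|[set y | b y == t]|) ->
  exists2 f : A -> B, injective f & forall x, b (f x) = a x.
Proof.
move=> le_fib.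
pose fA t := enum [set x | a x == t]; pose fB t := enum [set y | b y == t].
have [f fP] : exists f : A -> B,
    forall x, b (f x) = a x /\ index (f x) (fB (a x)) = index x (fA (a x)).
  apply: (@fin_all_exists _ (fun=> B)
    (fun x y => b y = a x /\ index y (fB (a x)) = index x (fA (a x)))) => x.
  have lt_idx : index x (fA (a x)) < size (fB (a x)).
    rewrite -cardE; apply: leq_trans (le_fib _).
    by rewrite cardE index_mem mem_enum inE.
  case def_fB: (fB (a x)) lt_idx => [//|y0 fB'] lt_idx.
  exists (nth y0 (fB (a x)) (index x (fA (a x)))); split.
    apply/eqP; have := mem_nth y0 lt_idx.
    by rewrite -def_fB mem_enum inE.
  by rewrite -def_fB index_uniq ?enum_uniq // def_fB.
exists f => [x x' eq_f|x]; last by case: (fP x).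
have [bx ix] := fP x; have [bx' ix'] := fP x'.
have eq_a : a x = a x' by rewrite -bx -bx' eq_f.
move: ix; rewrite eq_f eq_a ix' => /esym.
by apply: (index_inj x); rewrite /fA mem_enum inE ?eq_a.
Qed.

Lemma fiber_bijection (T : eqType) (A B : finType) (a : A -> T) (b : B -> T) :
  (forall t, #|[set x | a x == t]| = #|[set y | b y == t]|) ->
  exists2 f : A -> B, bijective f & forall x, b (f x) = a x.
Proof.
move=> eq_fib.
have [f inj_f fP] : exists2 f : A -> B, injective f & forall x, b (f x) = a x.
  by apply: fiber_injection => t; rewrite eq_fib.
have [g inj_g _] : exists2 g : B -> A, injective g & forall y, a (g y) = b y.
  by apply: fiber_injection => t; rewrite eq_fib.
by exists f => //; exact: inj_card_bij inj_f (leq_card g inj_g).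
Qed.

Lemma cr_equivalent_bijection (G H : sgraph) : cr_equivalent G H ->
  exists2 f : G -> H, bijective f &
    forall u, stable_color (inr (f u) : dunion G H)
            = stable_color (inl u : dunion G H).
Proof.
move=> crGH.
apply: (@fiber_bijection _ G H (fun u => stable_color (inl u : dunion G H))
  (fun v => stable_color (inr v : dunion G H))) => t.
have [x /eqP <-|no_x] := pickP (fun x : dunion G H => stable_color x == t).
  have := crGH _ (stable_color_classP x).
  by congr (_ = _); apply: eq_card => y; rewrite !inE eq_sym.
by rewrite !eq_card0 // => y; rewrite inE no_x.
Qed.

(** The color-preserving bijection matches the entries of the word vectors. *)
Lemma cr_equivalent_principal (R : realType) (G H : sgraph) :
  cr_equivalent G H -> principal_equivalent R G H.
Proof.
move=> /cr_equivalent_bijection[f bij_f fP].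
apply: principal_equivalent_walk => s.
rewrite [RHS](reindex f); last exact: onW_bij.
apply: eq_bigr => u _.
by rewrite -(walk_inl H s u) -(walk_inr G s (f u)) (walk_stable_color s (fP u)).
Qed.

(** In the disjoint union with an equivalent graph, distinct vertices of [G] have
    distinct colors.  The color-preserving bijection is then an isomorphism: [v]
    is a neighbor of [u] if and only if [u] has some neighbor with the color of
    [v], which can be read off from the color of [u]. *)
Lemma walk_injective_amenable (G : sgraph) s :
  injective (@walk G s) -> amenable G.
Proof.
move=> inj_s H /cr_equivalent_bijection[f bij_f fP].
have injG (u v : G) : stable_color (inl u : dunion G H) =
    stable_color (inl v : dunion G H) -> u = v.
  by move=> /(walk_stable_color s); rewrite !walk_inl => /inj_s.
exists f => // u v; apply/idP/idP => [adj_f|adj_uv].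
  have [[v'|v'] //= adj_uv'] :=
    stable_color_adj (fP u) (adj_f : @adj (dunion G H) (inr _) (inr _)).
  by rewrite fP => /injG ->.
have [[v'|v'] //= adj_fuv'] :=
  stable_color_adj (esym (fP u)) (adj_uv : @adj (dunion G H) (inl _) (inl _)).
have [g _ fK] := bij_f; rewrite -(fK v') in adj_fuv' *.
by rewrite fP => /injG ->.
Qed.

(** * Intertwiners *)

Section Intertwiner.
Local Open Scope ring_scope.

(** As [M] commutes with the letters, it carries the word vectors of [G] to [c]
    times those of [H]; summing over [v] and using the column sums cancels
    [c].  A nonnegative such [M] would only relate color refinement equivalent
    graphs: the interest lies in the negative entries. *)
Lemma intertwiner_principal (R : realType) (G H : sgraph)
    (M : H -> G -> int) (c : int) :
  c != 0 ->
  (forall v, \sum_u M v u = c) -> (forall u, \sum_v M v u = c) ->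
  (forall v u, M v u != 0 -> #|neighbors v| = #|neighbors u|) ->
  (forall v u, \sum_(v' | adj v v') M v' u = \sum_(u' | adj u' u) M v u') ->
  principal_equivalent R G H.
Proof.
move=> c_neq0 row_sum col_sum deg_M adj_M.
have transport s v : \sum_u M v u * (walk s u)%:Z = c * (walk s v)%:Z.
  elim: s v => [|[] s IH] v /=.
  - by rewrite mulr1 -(row_sum v); apply: eq_bigr => u _; rewrite mulr1.
  - rewrite PoszM mulrCA -IH mulr_sumr; apply: eq_bigr => u _.
    have [->|/deg_M <-] := eqVneq (M v u) 0; first by rewrite !mul0r mulr0.
    by rewrite PoszM mulrCA.
  have -> : (\sum_(v' | adj v v') walk s v')%N%:Z = \sum_(v' | adj v v') (walk s v')%:Z.
    exact: (big_morph Posz PoszD).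
  rewrite mulr_sumr; under [RHS]eq_bigr do rewrite -IH.
  rewrite exchange_big /=; under [RHS]eq_bigr do rewrite -mulr_suml adj_M mulr_suml.
  rewrite (exchange_big_dep xpredT) //=; apply: eq_bigr => u' _.
  by rewrite (big_morph Posz PoszD (erefl 0)) mulr_sumr.
apply: principal_equivalent_walk => s; apply/eqP.
rewrite -eqz_nat; apply/eqP/(mulfI c_neq0).
rewrite !(big_morph Posz PoszD (erefl 0)) !mulr_sumr.
under [RHS]eq_bigr do rewrite -transport.
rewrite exchange_big /=; apply: eq_bigr => u _.
by rewrite -mulr_suml col_sum.
Qed.

End Intertwiner.


(** * Two graphs related by a switching *)

(** The vertices 0 to 3 are the points, and 4 to 9 are the pairs in this order.
    The order matters because the path joins consecutive vertices. *)
Definition pair_points (p : nat) : seq nat :=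
  nth [::] [:: [:: 0; 3]; [:: 0; 1]; [:: 0; 2]; [:: 1; 3]; [:: 2; 3]; [:: 1; 2]]
    (p - 4).

(** Adjacency for [i < j].  A point is joined to the pairs that contain it if
    [inc] holds, and to the other pairs if not; the last line is the path on the
    pairs 4, 5, 6, 7. *)
Definition half_edge (inc : bool) (i j : nat) : bool :=
  if j < 4 then false
  else if i < 4 then (i \in pair_points j) == inc
  else (j == i.+1) && (j < 8).

Definition design_edge (inc : bool) : rel nat :=
  fun i j => half_edge inc i j || half_edge inc j i.

Definition design_adj (inc : bool) : rel 'I_10 := fun i j => design_edge inc i j.

Lemma design_adj_sym inc : symmetric (design_adj inc).
Proof. by move=> i j; rewrite /design_adj /design_edge orbC. Qed.

Lemma design_adj_irr inc : irreflexive (design_adj inc).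
Proof.
move=> i; rewrite /design_adj /design_edge orbb /half_edge.
by case: ltnP => // _; rewrite ltn_eqF.
Qed.

Definition design_graph inc : sgraph :=
  SGraph (design_adj_sym inc) (design_adj_irr inc).

(** Sums and quantifiers over ordinals do not compute, so they are replaced by
    folds and boolean tests over lists of natural numbers. *)
Definition design_nbrs inc (i : nat) : seq nat :=
  [seq j <- iota 0 10 | design_edge inc i j].

Lemma big_design_adj (S : Type) (x : S) (op : Monoid.com_law x) inc
    (i : design_graph inc) (F : nat -> S) :
  \big[op/x]_(j : design_graph inc | adj i j) F j
  = foldr op x [seq F j | j <- design_nbrs inc i].
Proof.
rewrite foldrE big_map big_filter -(big_mkord (design_edge inc i) F).
by rewrite /index_iota subn0.
Qed.

Lemma big_design (S : Type) (x : S) (op : Monoid.com_law x) inc (F : nat -> S) :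
  \big[op/x]_(j : design_graph inc) F j = foldr op x [seq F j | j <- iota 0 10].
Proof. by rewrite foldrE big_map -(big_mkord xpredT F) /index_iota subn0. Qed.

Lemma card_design_nbrs inc (i : design_graph inc) :
  #|neighbors i| = size (design_nbrs inc i).
Proof.
rewrite card_neighbors (big_design_adj _ i (fun=> 1)) /=.
by elim: (design_nbrs inc i) => //= _ l ->.
Qed.

Lemma all_design inc (P : pred nat) :
  all P (iota 0 10) -> forall i : design_graph inc, P i.
Proof. by move=> /allP allP i; apply: allP; rewrite mem_iota /= ltn_ord. Qed.

Lemma all2_design inc inc' (P : rel nat) :
  all (fun i => all (P i) (iota 0 10)) (iota 0 10) ->
  forall (i : design_graph inc) (j : design_graph inc'), P i j.
Proof.
move=> allP i; apply: (@all_design inc' (P i)).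
exact: (@all_design inc (fun k => all (P k) (iota 0 10))).
Qed.

Fixpoint design_walk inc (k : nat) (i : nat) : nat :=
  if k is k'.+1 then sumn [seq design_walk inc k' j | j <- design_nbrs inc i]
  else 1.

Lemma walk_design inc k (i : design_graph inc) :
  walk (nseq k false) i = design_walk inc k i.
Proof.
elim: k i => //= k IH i; under eq_bigr do rewrite IH.
by rewrite (big_design_adj _ i).
Qed.

Lemma design_amenable : amenable (design_graph true).
Proof.
(* Length 2 does not suffice: the points 2 and 3 both start eight such walks. *)
apply: (@walk_injective_amenable _ (nseq 3 false)) => i j.
rewrite !walk_design => eq_ij; apply/val_inj.
have uniq_w : uniq [seq design_walk true 3 k | k <- iota 0 10] by vm_compute.
have := uniqP 0 uniq_w i j.
rewrite !inE size_map size_iota !(nth_map 0) ?size_iota // !nth_iota //.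
exact.
Qed.

(** No permutation of the points sends every pair to its complement, so the
    switching cannot be undone by relabeling. *)
Lemma design_not_isomorphic :
  ~ isomorphic (design_graph true) (design_graph false).
Proof.
case=> f bij_f mono_f.
(* The point 0 starts 11 walks of length 2 in the first graph. *)
have := walk_iso (nseq 2 false) (ord0 : design_graph true) bij_f mono_f.
rewrite !walk_design; apply/eqP.
by apply: (@all_design false
  (fun i => design_walk false 2 i != design_walk true 2 0)).
Qed.

Section Switching.
Local Open Scope ring_scope.

(** Twice the Godsil-McKay matrix: [J - 2I] on the points and [2I] on the pairs.
    The factor two makes the entries integers. *)
Definition switching (v u : nat) : int :=
  if (v < 4)%N && (u < 4)%N then 1 - (v == u)%:Z *+ 2 else (v == u)%:Z *+ 2.

Lemma design_principal_equivalent (R : realType) :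
  principal_equivalent R (design_graph true) (design_graph false).
Proof.
apply: (@intertwiner_principal R (design_graph true) (design_graph false)
  (fun v u : 'I_10 => switching v u) 2) => //.
- move=> v; rewrite (big_design _ true (switching v)); apply/eqP; move: v.
  by apply: (@all_design false
    (fun v => foldr +%R 0 [seq switching v u | u <- iota 0 10] == 2)).
- move=> u; rewrite (big_design _ false (switching^~ u)); apply/eqP; move: u.
  by apply: (@all_design true
    (fun u => foldr +%R 0 [seq switching v u | v <- iota 0 10] == 2)).
- move=> v u; rewrite !card_design_nbrs => neq0; apply/eqP; move: neq0.
  apply/implyP; move: v u.
  apply: (@all2_design false true (fun v u => (switching v u != 0) ==>
    (size (design_nbrs false v) == size (design_nbrs true u)))).
  by vm_compute.
move=> v u; under [RHS]eq_bigl do rewrite adj_sym.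
rewrite (big_design_adj _ v (switching^~ u)) (big_design_adj _ u (switching v)).
apply/eqP; move: v u; apply: (@all2_design false true (fun v u =>
  foldr +%R 0 [seq switching w u | w <- design_nbrs false v]
  == foldr +%R 0 [seq switching v w | w <- design_nbrs true u])).
by vm_compute.
Qed.

End Switching.

Theorem mainTheorem6 (R : realType) :
  (forall G : sgraph, principal_AD_rigid R G -> amenable G) /\
  (exists G : sgraph, amenable G /\ ~ principal_AD_rigid R G).
Proof.
split=> [G rigidG H /(@cr_equivalent_principal R)/rigidG //|].
exists (design_graph true); split; first exact: design_amenable.
move=> /(_ _ (@design_principal_equivalent R)); exact: design_not_isomorphic.
Qed.
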